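(* Let $\pi_1$ be a vanishing representation of $B^+$, let $\pi_2$ be a smooth representation of $B^+$, and let $\chi:T\to\overline{\mathbb{F}}_p^*$ be a character. Then $$\operatorname{Hom}_{B^+}(\pi_1\otimes\pi_2,\chi)=0.$$
   Context: $p$ is a prime, $F$ a finite extension of $\mathbb{Q}_p$ with a fixed uniformizer $\varpi$, and $k=\overline{\mathbb{F}}_p$. All representations are over $k$; tensor products are over $k$ with the diagonal action; $\operatorname{Hom}_{B^+}$ denotes $k$-linear $B^+$-equivariant maps. Smooth means that every vector has open stabilizer. Set $t=\begin{pmatrix}\varpi&0\\0&1\end{pmatrix}$, let $T\subset\mathrm{GL}_2(F)$ be the subgroup of diagonal matrices, and let $$B^+=\left\{\begin{pmatrix}x&y\\0&1\end{pmatrix}\,\middle|\,x\in\varpi^{\mathbb{Z}},\ y\in F\right\},\qquad U_1=\left\{\begin{pmatrix}1&b\\0&1\end{pmatrix}\,\middle|\,b\in\mathbb{Z}_p\right\}\cong\mathbb{Z}_p .$$ A character $\chi$ of $T$ is viewed as a one-dimensional representation of $B^+$ through $\begin{pmatrix}x&y\\0&1\end{pmatrix}\mapsto\chi\begin{pmatrix}x&0\\0&1\end{pmatrix}$ (so it is trivial on unipotent matrices). For a smooth representation $V$ of $\mathbb{Z}_p$, write $[a]:V\to V$ for the action of $a\in\mathbb{Z}_p$ and $\Delta:V\to V$, $\Delta v=[1]v-[0]v=[1]v-v$. Let $\pi$ be an infinite-dimensional smooth representation of $B^+$. If there is a $U_1$-subrepresentation $W\subseteq\pi$ such that (1) $\pi=\sum_{n\in\mathbb{N}}t^{-n}W$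 and (2) $\Delta W=W$, where $W$ is regarded as a representation of $\mathbb{Z}_p\cong U_1$, then $(\pi,W)$ is called a vanishing pair and $\pi$ a vanishing representation of $B^+$. *)

(* Defs.v *)
From HB Require Import structures.
From mathcomp Require Import all_boot all_order all_algebra all_field.
From mathcomp Require Import boolp classical_sets.
From mathcomp Require Import freeg zify ring.

Set Implicit Arguments.
Unset Strict Implicit.
Unset Printing Implicit Defensive.

Import GRing.Theory Num.Theory.

Local Open Scope classical_set_scope.
Local Open Scope ring_scope.
Local Open Scope quotient_scope.

(* Z_p as the inverse limit of the rings Z/p^n: a p-adic integer is the      *)
(* sequence of its reduced residues in [0, p^n[.                              *)
Record padic_seq (p : nat) := PadicSeq {
  residue : nat -> int;
  residueP : forall n, residue n = (residue n.+1 %% (p ^ n)%N%:Z)%Z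
}.

(* The (unused) primality proof is kept in the type so that the ring          *)
(* structures below can be inferred.                                          *)
Definition padic_int (p : nat) (p_pr : prime p) := padic_seq p.

Section PadicInt.

Variables (p : nat) (p_pr : prime p).
Local Notation Zp := (padic_int p_pr).
Local Notation q n := ((p ^ n)%N%:Z).

HB.instance Definition _ := gen_eqMixin Zp.
HB.instance Definition _ := gen_choiceMixin Zp.

Lemma padic_eqP (x y : Zp) : (forall n, residue x n = residue y n) -> x = y.
Proof.
case: x y => [x xP] [y yP] /= /funext eq_xy; rewrite eq_xy in xP *.
by congr PadicSeq; apply: Prop_irrelevance.
Qed.

Lemma modz_pow (a : int) m n : (m <= n)%N -> ((a %% q n)%Z = a %[mod q m])%Z.
Proof.
move=> le_mn; rewrite {2}(divz_eq a (q n)).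
have -> : q n = q (n - m) * q m by rewrite -PoszM -expnD subnK.
by rewrite mulrA modzMDl.
Qed.

Lemma residue_mod (x : Zp) n : (residue x n %% q n)%Z = residue x n.
Proof. by rewrite (residueP x) modz_mod. Qed.

Lemma residue_le (x : Zp) m n :
  (m <= n)%N -> (residue x n %% q m)%Z = residue x m.
Proof.
move=> /subnK <-; elim: (n - m)%N => [|d IHd]; first exact: residue_mod.
by rewrite -IHd addSn (residueP x (d + m)) modz_pow ?leq_addl.
Qed.

Section Limit.
Variables (f : nat -> int) (fP : forall n, (f n = f n.+1 %[mod q n])%Z).
Lemma padic_limP n : (f n %% q n)%Z = ((f n.+1 %% q n.+1)%Z %% q n)%Z.
Proof. by rewrite modz_pow. Qed.
Definition padic_lim : Zp := PadicSeq padic_limP.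
End Limit.

Lemma padic_of_intP (a : int) n : (a = a %[mod q n])%Z. Proof. by []. Qed.
Definition padic_of_int a : Zp := padic_lim (padic_of_intP a).

Lemma padic_addP (x y : Zp) n :
  (residue x n + residue y n = residue x n.+1 + residue y n.+1 %[mod q n])%Z.
Proof. by rewrite (residueP x n) (residueP y n) modzDm. Qed.
Definition padic_add x y := padic_lim (padic_addP x y).

Lemma padic_oppP (x : Zp) n : (- residue x n = - residue x n.+1 %[mod q n])%Z.
Proof. by rewrite (residueP x n) modzNm. Qed.
Definition padic_opp x := padic_lim (padic_oppP x).

Lemma padic_mulP (x y : Zp) n :
  (residue x n * residue y n = residue x n.+1 * residue y n.+1 %[mod q n])%Z.
Proof. by rewrite (residueP x n) (residueP y n) modzMm. Qed.
Definition padic_mul x y := padic_lim (padic_mulP x y).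

Lemma padic_addA : associative padic_add.
Proof.
by move=> x y z; apply: padic_eqP => n /=; rewrite modzDml modzDmr addrA.
Qed.
Lemma padic_addC : commutative padic_add.
Proof. by move=> x y; apply: padic_eqP => n /=; rewrite addrC. Qed.
Lemma padic_add0 : left_id (padic_of_int 0) padic_add.
Proof.
by move=> x; apply: padic_eqP => n /=; rewrite modzDml add0r residue_mod.
Qed.
Lemma padic_addN : left_inverse (padic_of_int 0) padic_opp padic_add.
Proof. by move=> x; apply: padic_eqP => n /=; rewrite modzDml addNr. Qed.

HB.instance Definition _ :=
  GRing.isZmodule.Build Zp padic_addA padic_addC padic_add0 padic_addN.

Lemma padic_mulA : associative padic_mul.
Proof.
by move=> x y z; apply: padic_eqP => n /=; rewrite modzMml modzMmr mulrA.
Qed.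
Lemma padic_mulC : commutative padic_mul.
Proof. by move=> x y; apply: padic_eqP => n /=; rewrite mulrC. Qed.
Lemma padic_mul1 : left_id (padic_of_int 1) padic_mul.
Proof.
by move=> x; apply: padic_eqP => n /=; rewrite modzMml mul1r residue_mod.
Qed.
Lemma padic_mulD : left_distributive padic_mul padic_add.
Proof.
by move=> x y z; apply: padic_eqP => n /=; rewrite modzMml modzDm mulrDl.
Qed.
Lemma padic_1_neq0 : padic_of_int 1 != 0.
Proof.
apply/eqP => /(congr1 (fun x : Zp => residue x 1%N)) /=.
by rewrite expn1 mod0z modz_small //= ltz_nat prime_gt1.
Qed.

HB.instance Definition _ := GRing.Zmodule_isComNzRing.Build Zp
  padic_mulA padic_mulC padic_mul1 padic_mulD padic_1_neq0.

Definition padic_unit : {pred Zp} := [pred x | `[< exists y, y * x = 1 >]].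
Definition padic_inv (x : Zp) : Zp :=
  if pselect (exists y, y * x = 1) is left ex then sval (cid ex) else x.

Lemma padic_mulV : {in padic_unit, left_inverse 1 padic_inv *%R}.
Proof.
move=> x /asboolP ex; rewrite /padic_inv; case: pselect => // ex'.
exact: (svalP (cid ex')).
Qed.
Lemma padic_unitPl (x y : Zp) : y * x = 1 -> padic_unit x.
Proof. by move=> xy; apply/asboolP; exists y. Qed.
Lemma padic_inv_out : {in [predC padic_unit], padic_inv =1 id}.
Proof.
move=> x /= /asboolP nex; rewrite /padic_inv.
by case: pselect => // ex; case: nex.
Qed.

HB.instance Definition _ := GRing.ComNzRing_hasMulInverse.Build Zp
  padic_mulV padic_unitPl padic_inv_out.

Lemma padic_neq0 (x : Zp) : x != 0 -> exists n, ~~ (q n %| residue x n)%Z.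
Proof.
move=> x_neq0; apply: contrapT => dvd_x; case/eqP: x_neq0.
apply: padic_eqP => n /=; rewrite mod0z -residue_mod.
by apply/dvdz_mod0P/negPn/negP => ndvd; apply: dvd_x; exists n.
Qed.

Lemma padic_idomain : GRing.integral_domain_axiom Zp.
Proof.
move=> x y xy0; rewrite -[_ || _]negbK negb_or; apply/negP => /andP[].
move=> /padic_neq0[m ndvd_x] /padic_neq0[n ndvd_y].
move/(congr1 (fun z : Zp => residue z (m + n))): xy0 => /=.
rewrite mod0z => /dvdz_mod0P.
set a := residue x _; set b := residue y _ => dvd_ab.
have nda : ~~ (q m %| a)%Z.
  by apply: contra ndvd_x => /dvdz_mod0P dvd; apply/dvdz_mod0P;
     rewrite -(residue_le x (leq_addr n m)) modz_mod.
have ndb : ~~ (q n %| b)%Z.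
  by apply: contra ndvd_y => /dvdz_mod0P dvd; apply/dvdz_mod0P;
     rewrite -(residue_le y (leq_addl m n)) modz_mod.
move: nda ndb dvd_ab; rewrite !dvdzE abszM !absz_nat.
case: (posnP `|a|) => [->|a_gt0]; first by rewrite dvdn0.
case: (posnP `|b|) => [->|b_gt0]; first by rewrite dvdn0.
by rewrite !pfactor_dvdn ?muln_gt0 ?a_gt0 // lognM //; lia.
Qed.

HB.instance Definition _ := GRing.ComUnitRing_isIntegral.Build Zp padic_idomain.

End PadicInt.

Definition padic_field (p : nat) (p_pr : prime p) := {fraction padic_int p_pr}.
HB.instance Definition _ p (p_pr : prime p) :=
  GRing.Field.on (padic_field p_pr).

Section Units.

Variable R : unitRingType.

Record units_of := UnitOf { unit_val :> R; _ : unit_val \is a GRing.unit }.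

HB.instance Definition _ := [isSub for unit_val].
HB.instance Definition _ := [Choice of units_of by <:].

Lemma unit_valP (u : units_of) : (u : R) \is a GRing.unit.
Proof. exact: valP u. Qed.

Lemma units_mulP (u v : units_of) : (u : R) * (v : R) \is a GRing.unit.
Proof. by rewrite unitrMr ?unit_valP. Qed.
Lemma units_invP (u : units_of) : (u : R)^-1 \is a GRing.unit.
Proof. by rewrite unitrV unit_valP. Qed.

Definition units_one := UnitOf (unitr1 R).
Definition units_mul u v := UnitOf (units_mulP u v).
Definition units_inv u := UnitOf (units_invP u).

Lemma units_mulA : associative units_mul.
Proof. by move=> u v w; apply: val_inj; rewrite /= mulrA. Qed.
Lemma units_mul1 : left_id units_one units_mul.
Proof. by move=> u; apply: val_inj; rewrite /= mul1r. Qed.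
Lemma units_mulr1 : right_id units_one units_mul.
Proof. by move=> u; apply: val_inj; rewrite /= mulr1. Qed.
Lemma units_mulV : left_inverse units_one units_inv units_mul.
Proof. by move=> u; apply: val_inj; rewrite /= mulVr ?unit_valP. Qed.
Lemma units_mulrV : right_inverse units_one units_inv units_mul.
Proof. by move=> u; apply: val_inj; rewrite /= mulrV ?unit_valP. Qed.

HB.instance Definition _ :=
  isGroup.Build units_of units_mulA units_mul1 units_mulr1
    units_mulV units_mulrV.

End Units.

Section Representations.

Variables (k : fieldType) (G : groupType).

Record rep := Rep {
  rep_space :> lmodType k;
  rep_act : G -> rep_space -> rep_space;
  rep_act_linear : forall g, linear (rep_act g);
  rep_act1 : forall v, rep_act 1%g v = v;
  rep_actM : forall g h v, rep_act (g * h)%g v = rep_act g (rep_act h v)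
}.

Definition rep_hom (V W : rep) : set (V -> W) :=
  [set f | linear f /\ forall g v, f (rep_act g v) = rep_act g (f v)].

Definition infinite_dimensional (V : lmodType k) : Prop :=
  ~ exists n (e : 'I_n -> V),
      forall v, exists c : 'I_n -> k, v = \sum_i c i *: e i.

End Representations.

Arguments rep_hom {k G} V W.

HB.instance Definition _ (k : fieldType) (G : groupType) (V : rep k G) g :=
  GRing.isLinear.Build k V V *:%R (@rep_act k G V g) (@rep_act_linear k G V g).

(* The tensor product: the free module on V * W modulo the bilinearity       *)
(* relations.                                                                *)
Section Tensor.

Variables (k : fieldType) (V W : lmodType k).

Definition free_tens (v : V) (w : W) : {freeg (V * W)%type / k} :=
  [freeg [:: (1, (v, w))]].

Inductive tensor_relation : {freeg (V * W)%type / k} -> Prop :=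
| TensorRel0 : tensor_relation 0
| TensorRelD x y :
    tensor_relation x -> tensor_relation y -> tensor_relation (x + y)
| TensorRelZ c x : tensor_relation x -> tensor_relation (c *: x)
| TensorRelDl v v' w :
    tensor_relation (free_tens (v + v') w - free_tens v w - free_tens v' w)
| TensorRelDr v w w' :
    tensor_relation (free_tens v (w + w') - free_tens v w - free_tens v w')
| TensorRelZl c v w :
    tensor_relation (free_tens (c *: v) w - c *: free_tens v w)
| TensorRelZr c v w :
    tensor_relation (free_tens v (c *: w) - c *: free_tens v w).

Definition tensor_null : {pred {freeg (V * W)%type / k}} :=
  fun x => `[< tensor_relation x >].

Lemma tensor_null_submod : subsemimod_closed tensor_null.
Proof.
split; first split.
- exact/asboolP/TensorRel0.
- by move=> x y /asboolP xP /asboolP yP; apply/asboolP/TensorRelD.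
by move=> c x /asboolP xP; apply/asboolP/TensorRelZ.
Qed.

HB.instance Definition _ := GRing.isSubmodClosed.Build
  k {freeg (V * W)%type / k} tensor_null tensor_null_submod.

Definition tensor := Quotient.quot tensor_null.
HB.instance Definition _ := GRing.Zmodule.on tensor.

Local Notation "\cl x" := (\pi_(Quotient.quot tensor_null) x : tensor)
  (at level 10, x at level 8).

Lemma tensor_clP x y : reflect (\cl x = \cl y) (x - y \in tensor_null).
Proof. by rewrite Quotient.idealrBE; apply: eqP. Qed.

Lemma tensor_clD x y : \cl (x + y) = \cl x + \cl y.
Proof. exact: (raddfD (\pi_(Quotient.quot tensor_null))). Qed.

Definition tensor_scale (c : k) (u : tensor) : tensor :=
  \cl (c *: repr (u : Quotient.quot tensor_null)).

Lemma tensor_clZ c x : \cl (c *: x) = tensor_scale c (\cl x).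
Proof.
apply/tensor_clP; rewrite -scalerBr rpredZ //.
by apply/tensor_clP; rewrite reprK.
Qed.

Lemma tensor_clW (P : tensor -> Prop) : (forall x, P (\cl x)) -> forall u, P u.
Proof. by move=> Pcl u; rewrite -[u](@reprK _ (Quotient.quot tensor_null)). Qed.

Lemma tensor_scaleA a b u :
  tensor_scale a (tensor_scale b u) = tensor_scale (a * b) u.
Proof. by elim/tensor_clW: u => x; rewrite -!tensor_clZ scalerA. Qed.
Lemma tensor_scale1 : left_id 1 tensor_scale.
Proof. by elim/tensor_clW => x; rewrite -tensor_clZ scale1r. Qed.
Lemma tensor_scaleDr : right_distributive tensor_scale +%R.
Proof.
move=> c; elim/tensor_clW => x; elim/tensor_clW => y.
by rewrite -tensor_clD -!tensor_clZ scalerDr tensor_clD.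
Qed.
Lemma tensor_scaleDl u :
  {morph tensor_scale^~ u : a b / a + b >-> a + b}.
Proof.
by elim/tensor_clW: u => x a b; rewrite -!tensor_clZ scalerDl tensor_clD.
Qed.

HB.instance Definition _ := GRing.Zmodule_isLmodule.Build k tensor
  tensor_scaleA tensor_scale1 tensor_scaleDr tensor_scaleDl.

Definition tens (v : V) (w : W) : tensor := \cl (free_tens v w).

Lemma tensDl v v' w : tens (v + v') w = tens v w + tens v' w.
Proof.
rewrite -tensor_clD; apply/tensor_clP/asboolP.
by rewrite opprD addrA; apply: TensorRelDl.
Qed.
Lemma tensDr v w w' : tens v (w + w') = tens v w + tens v w'.
Proof.
rewrite -tensor_clD; apply/tensor_clP/asboolP.
by rewrite opprD addrA; apply: TensorRelDr.
Qed.
Lemma tensZl c v w : tens (c *: v) w = c *: tens v w.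
Proof. by rewrite -[RHS]tensor_clZ; apply/tensor_clP/asboolP/TensorRelZl. Qed.
Lemma tensZr c v w : tens v (c *: w) = c *: tens v w.
Proof. by rewrite -[RHS]tensor_clZ; apply/tensor_clP/asboolP/TensorRelZr. Qed.

Lemma tensor_ind (P : tensor -> Prop) :
    P 0 -> (forall c v w u, P u -> P (c *: tens v w + u)) -> forall u, P u.
Proof.
move=> P0 PD; elim/tensor_clW; elim/freeg_ind_dom0 => [|c [v w] x _ _ Px].
  by rewrite (_ : \cl 0 = 0) //; apply: (raddf0 (\pi_(Quotient.quot tensor_null))).
rewrite (_ : [freeg [:: (c, (v, w))]] = c *: free_tens v w).
  by rewrite tensor_clD tensor_clZ; apply: PD.
by apply/eqP/freeg_eqP => z; rewrite coeffZ !coeffU mul1r.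
Qed.

Section Lift.

Variables (M : lmodType k) (b : V -> W -> M).
Hypothesis (b_linl : forall w, linear (b^~ w)) (b_linr : forall v, linear (b v)).

Definition free_lift (x : {freeg (V * W)%type / k}) : M :=
  fglift (fun vw => b vw.1 vw.2) x.

Lemma free_lift_tens v w : free_lift (free_tens v w) = b v w.
Proof. by rewrite /free_lift liftU scale1r. Qed.

Lemma free_liftB x y : free_lift (x - y) = free_lift x - free_lift y.
Proof. exact: lift_is_additive. Qed.

Lemma free_lift0 : free_lift 0 = 0.
Proof. by rewrite -(subrr 0) free_liftB subrr. Qed.

Lemma free_liftD x y : free_lift (x + y) = free_lift x + free_lift y.
Proof.
by rewrite -[y in LHS]opprK free_liftB -[- y]sub0r free_liftB free_lift0 sub0r opprK.
Qed.

Lemma free_liftZ c x : free_lift (c *: x) = c *: free_lift x.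
Proof.
elim/freeg_ind_dom0: x => [|a z x _ _ IHx].
  by rewrite scaler0 free_lift0 scaler0.
rewrite scalerDr !free_liftD scalerDr IHx; congr (_ + _).
rewrite (_ : c *: _ = [freeg [:: (c * a, z)]]) /free_lift ?liftU ?scalerA //.
by apply/eqP/freeg_eqP => y; rewrite coeffZ !coeffU mulrA.
Qed.

Lemma free_lift_null x : tensor_relation x -> free_lift x = 0.
Proof.
have [lD lZ] : (forall w v v', b (v + v') w = b v w + b v' w) /\
               (forall w c v, b (c *: v) w = c *: b v w).
  split=> w; first by move=> v v'; have := b_linl w 1 v v'; rewrite !scale1r.
  move=> c v; have b0 : b 0 w = 0.
    by have := b_linl w (-1) 0 0; rewrite scaleN1r oppr0 addr0 scaleN1r addNr.
  by have := b_linl w c v 0; rewrite !addr0 b0 addr0.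
have [rD rZ] : (forall v w w', b v (w + w') = b v w + b v w') /\
               (forall v c w, b v (c *: w) = c *: b v w).
  split=> v; first by move=> w w'; have := b_linr v 1 w w'; rewrite !scale1r.
  move=> c w; have b0 : b v 0 = 0.
    by have := b_linr v (-1) 0 0; rewrite scaleN1r oppr0 addr0 scaleN1r addNr.
  by have := b_linr v c w 0; rewrite !addr0 b0 addr0.
elim=> [|{}x y _ x0 _ y0|c {}x _ x0|v v' w|v w w'|c v w|c v w].
- exact: free_lift0.
- by rewrite free_liftD x0 y0 addr0.
- by rewrite free_liftZ x0 scaler0.
- by rewrite !free_liftB !free_lift_tens lD addrAC addrK subrr.
- by rewrite !free_liftB !free_lift_tens rD addrAC addrK subrr.
- by rewrite free_liftB free_liftZ !free_lift_tens lZ subrr.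
- by rewrite free_liftB free_liftZ !free_lift_tens rZ subrr.
Qed.

Definition tensor_lift (u : tensor) : M :=
  free_lift (repr (u : Quotient.quot tensor_null)).

Lemma tensor_lift_cl x : tensor_lift (\cl x) = free_lift x.
Proof.
apply/eqP; rewrite -subr_eq0 -free_liftB; apply/eqP/free_lift_null/asboolP.
by apply/tensor_clP; rewrite reprK.
Qed.

Lemma tensor_lift_tens v w : tensor_lift (tens v w) = b v w.
Proof. by rewrite tensor_lift_cl free_lift_tens. Qed.

Lemma tensor_lift_linear : linear tensor_lift.
Proof.
move=> c; elim/tensor_clW => x; elim/tensor_clW => y.
rewrite -[c *: _]tensor_clZ -tensor_clD !tensor_lift_cl.
by rewrite free_liftD free_liftZ.
Qed.

End Lift.

Lemma tensor_linear_ext (M : lmodType k) (f g : tensor -> M) :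
    linear f -> linear g -> (forall v w, f (tens v w) = g (tens v w)) -> f =1 g.
Proof.
have lin0 (h : tensor -> M) : linear h -> h 0 = 0.
  move=> h_lin; have := h_lin (-1) 0 0.
  by rewrite scaleN1r oppr0 addr0 scaleN1r addNr.
move=> f_lin g_lin fg; elim/tensor_ind => [|c v w u IHu]; first by rewrite !lin0.
by rewrite f_lin g_lin fg IHu.
Qed.

End Tensor.

Section TensorRep.

Variables (k : fieldType) (G : groupType) (V W : rep k G).

Definition tensor_act (g : G) : tensor V W -> tensor V W :=
  tensor_lift (fun v w => tens (rep_act g v) (rep_act g w)).

Lemma tensor_act_bilinl g (w : W) :
  linear (fun v : V => tens (rep_act g v) (rep_act g w)).
Proof. by move=> c v v'; rewrite linearP tensDl tensZl. Qed.
Lemma tensor_act_bilinr g (v : V) :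
  linear (fun w : W => tens (rep_act g v) (rep_act g w)).
Proof. by move=> c w w'; rewrite linearP tensDr tensZr. Qed.

Lemma tensor_act_tens g v w :
  tensor_act g (tens v w) = tens (rep_act g v) (rep_act g w).
Proof.
by rewrite /tensor_act tensor_lift_tens //;
  [exact: tensor_act_bilinl | exact: tensor_act_bilinr].
Qed.

Lemma tensor_act_linear g : linear (tensor_act g).
Proof.
by apply: tensor_lift_linear;
  [exact: tensor_act_bilinl | exact: tensor_act_bilinr].
Qed.

Lemma tensor_act1 u : tensor_act 1%g u = u.
Proof.
apply: (tensor_linear_ext (g := id) (tensor_act_linear _)) => // v w.
by rewrite tensor_act_tens !rep_act1.
Qed.

Lemma tensor_actM g h u : tensor_act (g * h)%g u = tensor_act g (tensor_act h u).
Proof.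
have lin : linear (fun u => tensor_act g (tensor_act h u)).
  by move=> c x y; rewrite !tensor_act_linear.
apply: (tensor_linear_ext (tensor_act_linear _) lin) => v w.
by rewrite !tensor_act_tens !rep_actM.
Qed.

Definition tensor_rep : rep k G :=
  Rep tensor_act_linear tensor_act1 tensor_actM.

End TensorRep.

Section GL2.

Variable F : fieldType.

Definition GL2 : groupType := units_of 'M[F]_2.

Definition GL2_mx (g : GL2) : 'M[F]_2 := unit_val g.

Definition mx2 (a b c d : F) : 'M[F]_2 :=
  \matrix_(i, j) if i == 0 then if j == 0 then a else b
                 else if j == 0 then c else d.

Lemma mx2P (A B : 'M[F]_2) :
    A 0 0 = B 0 0 -> A 0 1 = B 0 1 -> A 1 0 = B 1 0 -> A 1 1 = B 1 1 -> A = B.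
Proof.
move=> e00 e01 e10 e11; apply/matrixP => i j.
have ord2 (l : 'I_2) : l = 0 \/ l = 1.
  by case: l => [[|[|//]]] ltl2; [left | right]; apply: val_inj.
by case: (ord2 i) => ->; case: (ord2 j) => ->.
Qed.

Lemma mx2_1 : mx2 1 0 0 1 = 1.
Proof. by apply: mx2P; rewrite !mxE. Qed.

Lemma mx2_mul a b c d a' b' c' d' :
  mx2 a b c d * mx2 a' b' c' d' =
    mx2 (a * a' + b * c') (a * b' + b * d') (c * a' + d * c') (c * b' + d * d').
Proof.
by apply: mx2P; rewrite !mxE !big_ord_recl big_ord0 !mxE /= addr0.
Qed.

Lemma mx2_unit a b d : a != 0 -> d != 0 -> mx2 a b 0 d \is a GRing.unit.
Proof.
move=> a0 d0; apply/unitrP; exists (mx2 a^-1 (- b / (a * d)) 0 d^-1).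
by rewrite !mx2_mul -mx2_1; split; congr mx2; field; rewrite ?a0 ?d0.
Qed.

Lemma mx2_inv a b d : a != 0 -> d != 0 ->
  (mx2 a b 0 d)^-1 = mx2 a^-1 (- b / (a * d)) 0 d^-1.
Proof.
move=> a0 d0; apply: (mulrI (mx2_unit b a0 d0)); rewrite mulrV ?mx2_unit //.
by rewrite mx2_mul -mx2_1; congr mx2; field; rewrite ?a0 ?d0.
Qed.

Lemma mx2_unit_neq0 a b d :
  mx2 a b 0 d \is a GRing.unit -> (a != 0) /\ (d != 0).
Proof.
case/unitrP => B [BA AB]; split.
  apply/eqP => a0; move/matrixP/(_ 0 0): BA.
  rewrite !mxE !big_ord_recl big_ord0 !mxE /= a0 !mulr0 !addr0.
  by move/esym/eqP; rewrite oner_eq0.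
apply/eqP => d0; move/matrixP/(_ 1 1): AB.
rewrite !mxE !big_ord_recl big_ord0 !mxE /= d0 !mul0r !addr0.
by move/esym/eqP; rewrite oner_eq0.
Qed.

Definition torus_pred : pred GL2 :=
  fun g => `[< exists a d, GL2_mx g = mx2 a 0 0 d >].

Lemma torus_closed : group_closed torus_pred.
Proof.
split; first by apply/asboolP; exists 1, 1; rewrite mx2_1.
move=> g h /asboolP[a [d gE]] /asboolP[a' [d' hE]]; apply/asboolP.
have := unit_valP h; rewrite -/(GL2_mx h) hE => /mx2_unit_neq0[a'0 d'0].
exists (a / a'), (d / d'); rewrite /GL2_mx /= -!/(GL2_mx _) gE hE mx2_inv // mx2_mul.
by congr mx2; rewrite ?(oppr0, mul0r, mulr0, addr0, add0r).
Qed.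

Record torus := Torus { torus_val :> GL2; _ : torus_pred torus_val }.

HB.instance Definition _ := [isSub for torus_val].
HB.instance Definition _ := [Choice of torus by <:].
HB.instance Definition _ :=
  SubChoice_isSubGroup.Build GL2 torus_pred torus torus_closed.

Lemma torus_elt_subproof (a : F) (a0 : a != 0) :
  torus_pred (UnitOf (mx2_unit 0 a0 (oner_neq0 F))).
Proof. by apply/asboolP; exists a, 1. Qed.

(* The matrix (a, 0; 0, 1). *)
Definition torus_elt (a : F) (a0 : a != 0) : torus :=
  Torus (torus_elt_subproof a0).

End GL2.

Section LocalField.

Variables (p : nat) (p_pr : prime p) (F : fieldExtType (padic_field p_pr)).

Definition padic_in (a : padic_int p_pr) : F := (FracField.tofrac a)%:A.

(* The ring of integers of F: the integral closure of Z_p. *)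
Definition integers : set F := [set x | integralOver padic_in x].

(* An element is a uniformizer when it is nonzero and generates the maximal   *)
(* ideal of the local ring of integers, that is the set of its nonunits.      *)
Definition is_uniformizer (w : F) : Prop :=
  w != 0 /\
  [set x | integers x /\ ~ exists2 y, integers y & x * y = 1] =
    [set w * y | y in integers].

Record uniformizer := Uniformizer {
  uniformizer_val :> F;
  _ : is_uniformizer uniformizer_val
}.

Lemma uniformizer_neq0 (w : uniformizer) : (w : F) != 0.
Proof. by case: w => w []. Qed.

(* The sets p^n O_F form a neighborhood basis of 0 in F. *)
Definition padic_ball (n : nat) : set F := [set p%:R ^+ n * y | y in integers].

Definition GL2_nbhs (g : GL2 F) (n : nat) : set (GL2 F) :=
  [set h | forall i j, padic_ball n (GL2_mx h i j - GL2_mx g i j)].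

Variable w : uniformizer.

Definition Bplus_pred : pred (GL2 F) :=
  fun g => `[< exists (z : int) (y : F), GL2_mx g = mx2 (uniformizer_val w ^ z) y 0 1 >].

Lemma Bplus_closed : group_closed Bplus_pred.
Proof.
have w0 z : (w : F) ^ z != 0 by rewrite expfz_neq0 ?uniformizer_neq0.
split; first by apply/asboolP; exists 0, 0; rewrite expr0z mx2_1.
move=> g h /asboolP[m [y gE]] /asboolP[n [y' hE]]; apply/asboolP.
exists (m - n), ((w : F) ^ m * (- y' / ((w : F) ^ n * 1)) + y / 1).
rewrite /GL2_mx /= -!/(GL2_mx _) gE hE mx2_inv ?oner_eq0 // mx2_mul.
congr mx2; rewrite ?(mul0r, mulr0, addr0, add0r, mulr1, invr1) //.
by rewrite expfzDr ?uniformizer_neq0 // invr_expz.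
Qed.

Record Bplus := BplusElt { Bplus_val :> GL2 F; _ : Bplus_pred Bplus_val }.

HB.instance Definition _ := [isSub for Bplus_val].
HB.instance Definition _ := [Choice of Bplus by <:].
HB.instance Definition _ :=
  SubChoice_isSubGroup.Build (GL2 F) Bplus_pred Bplus Bplus_closed.

Definition Bplus_open (S : set Bplus) : Prop :=
  forall g, S g -> exists n, forall h : Bplus, GL2_nbhs g n h -> S h.

Lemma Bplus_t_subproof :
  Bplus_pred (UnitOf (mx2_unit 0 (uniformizer_neq0 w) (oner_neq0 F))).
Proof. by apply/asboolP; exists 1, 0; rewrite expr1z. Qed.

(* t = (w, 0; 0, 1) *)
Definition Bplus_t : Bplus := BplusElt Bplus_t_subproof.

Lemma Bplus_u_subproof (b : F) :
  Bplus_pred (UnitOf (mx2_unit b (oner_neq0 F) (oner_neq0 F))).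
Proof. by apply/asboolP; exists 0, b; rewrite expr0z. Qed.

(* (1, b; 0, 1) *)
Definition Bplus_u (b : F) : Bplus := BplusElt (Bplus_u_subproof b).

Lemma Bplus_diag_neq0 (g : Bplus) : GL2_mx g 0 0 != 0.
Proof.
case: g => g /= /asboolP[z [y ->]].
by rewrite mxE expfz_neq0 ?uniformizer_neq0.
Qed.

Definition Bplus_diag (g : Bplus) : torus F := torus_elt (Bplus_diag_neq0 g).

Lemma Bplus_diagM (g h : Bplus) :
  Bplus_diag (g * h)%g = (Bplus_diag g * Bplus_diag h)%g.
Proof.
do 2!apply: val_inj => /=; rewrite mx2_mul.
case: g h => [g /= /asboolP[m [y gE]]] [h /= /asboolP[n [y' hE]]].
rewrite {1}/GL2_mx /= -!/(GL2_mx _) gE hE mx2_mul !mxE /=.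
by congr mx2; ring.
Qed.

Lemma Bplus_diag1 : Bplus_diag 1%g = 1%g.
Proof. by do 2!apply: val_inj => /=; rewrite mxE mx2_1. Qed.

End LocalField.

Section Vanishing.

Variables (p : nat) (p_pr : prime p) (F : fieldExtType (padic_field p_pr)).
Variables (w : uniformizer F) (k : fieldType).

(* Pulled back to B^+ along (x, y; 0, 1) |-> (x, 0; 0, 1). *)
Section CharacterRep.

Variable chi : UMagmaMorphism.type (torus F) (units_of k).

Definition character_act (g : Bplus w) (v : k^o) : k^o :=
  unit_val (chi (Bplus_diag g)) *: v.

Lemma character_act_linear g : linear (character_act g).
Proof. exact: linearP (GRing.scale _). Qed.
Lemma character_act1 v : character_act 1%g v = v.
Proof. by rewrite /character_act Bplus_diag1 gmulf1 scale1r. Qed.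
Lemma character_actM g h v :
  character_act (g * h)%g v = character_act g (character_act h v).
Proof. by rewrite /character_act Bplus_diagM gmulfM scalerA. Qed.

Definition character_rep : rep k (Bplus w) :=
  Rep character_act_linear character_act1 character_actM.

End CharacterRep.

Definition smooth (V : rep k (Bplus w)) : Prop :=
  forall v : V, Bplus_open [set g | rep_act g v = v].

(* Z_p acts through its identification with U_1. *)
Definition Zp_act (V : rep k (Bplus w)) (a : padic_int p_pr) (v : V) : V :=
  rep_act (Bplus_u w (padic_in F a)) v.

Definition Delta (V : rep k (Bplus w)) (v : V) : V :=
  Zp_act 1 v - Zp_act 0 v.

Record U1_subrep (V : rep k (Bplus w)) (W : set V) : Prop := {
  U1_subrep0 : W 0;
  U1_subrepP : forall (c : k) v v', W v -> W v' -> W (c *: v + v');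
  U1_subrep_act : forall a v, W v -> W (Zp_act a v)
}.

Record vanishing_pair (V : rep k (Bplus w)) (W : set V) : Prop := {
  vanishing_dim : infinite_dimensional V;
  vanishing_smooth : smooth V;
  vanishing_subrep : U1_subrep W;
  vanishing_sum : forall v : V, exists (m : nat) (x : nat -> V),
    (forall n, W (x n)) /\ v = \sum_(n < m) rep_act (Bplus_t w ^- n)%g (x n);
  vanishing_Delta : [set Delta v | v in W] = W
}.

Definition vanishing (V : rep k (Bplus w)) : Prop :=
  exists W : set V, vanishing_pair W.

End Vanishing.

(* Main.v *)
Require Import Defs.
From mathcomp Require Import all_boot all_order all_algebra all_field.
From mathcomp Require Import boolp classical_sets.

(** A homomorphism [f] from [pi1 (x) pi2] to [chi] is a bilinear form that is
    equivariant up to [chi], and [chi] is trivial on the unipotent matrices.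
    Write [u] for the action of the matrix (1, 1; 0, 1), so that
    [Delta = u - 1].

    Since [pi1] is the sum of the translates of [W] by powers of [t^-1],
    equivariance under [t] reduces the claim to [f (x (x) w) = 0] for [x] in [W]
    and [w] in [pi2] ([W_tens_eq0] gives this, [hom_tens_eq0] the reduction).
    By smoothness some [u^(p^m)] fixes [w].  In characteristic [p],
    [Delta^(p^m) = u^(p^m) - 1] ([iter_pow_char]), and [Delta W = W] lets us
    write [x = Delta^(p^m) y].  Hence
    [f (x (x) w) = f (u^(p^m) y (x) u^(p^m) w) - f (y (x) w) = 0]. *)

Set Implicit Arguments.
Unset Strict Implicit.
Unset Printing Implicit Defensive.

Import GRing.Theory.

Local Open Scope classical_set_scope.
Local Open Scope ring_scope.

(** The binomial theorem for [(1 + d)^n]; expanding [f] in powers of [d], and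
    not [d] in powers of [f], keeps signs out of the formula. *)
Lemma iter_binomial (V : zmodType) (f d : V -> V) (n : nat) (v : V) :
    {morph d : x y / x + y} -> (forall x, f x = x + d x) ->
  iter n f v = \sum_(i < n.+1) iter i d v *+ 'C(n, i).
Proof.
move=> dD fE.
have d0 : d 0 = 0 by apply: (addrI (d 0)); rewrite -dD !addr0.
have dMn x m : d (x *+ m) = d x *+ m.
  by elim: m => [|m IHm]; rewrite ?mulr0n // !mulrS dD IHm.
elim: n => [|n IHn]; first by rewrite big_ord1.
rewrite iterS fE IHn (big_morph d dD d0) [RHS]big_ord_recl.
rewrite [in RHS](eq_bigr (fun i : 'I_n.+1 =>
  iter i.+1 d v *+ 'C(n, i.+1) + d (iter i d v *+ 'C(n, i)))); last first.
  by move=> i _; rewrite /= binS mulrnDr dMn.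
rewrite big_split addrA; congr (_ + _).
by rewrite big_ord_recl [in RHS]big_ord_recr /= !bin0 bin_small // mulr0n addr0.
Qed.

(** Freshman's dream [(1 + d)^(p^m) = 1 + d^(p^m)] on a group killed by [p].
    The induction step is the exponent [p] applied to [d^(p^m)], where the
    inner binomial coefficients are divisible by [p]. *)
Lemma iter_pow_char (V : zmodType) (p : nat) (f d : V -> V) (m : nat) (v : V) :
    prime p -> (forall x : V, x *+ p = 0) ->
    {morph d : x y / x + y} -> (forall x, f x = x + d x) ->
  iter (p ^ m) f v = v + iter (p ^ m) d v.
Proof.
move=> p_pr pV0 dD fE; elim: m => [|m IHm] in v *; first exact: fE.
set q := (p ^ m)%N in IHm *; rewrite expnS !iterM.
have dqD : {morph iter q d : x y / x + y}.
  by move=> x y; elim: q {IHm} => //= n ->.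
rewrite (iter_binomial p v dqD IHm).
(* Only [d^q] matters from here; [p] becomes a successor so that both ends of
   the sum can be split off. *)
move: (iter q d) => e; case: p p_pr pV0 {IHm q dqD fE dD} => // p p_pr pV0.
rewrite big_ord_recl big_ord_recr /= bin0 mulr1n /bump /= add1n binn mulr1n.
rewrite big1 ?add0r // => i _.
have /dvdnP[c ->] : (p.+1 %| 'C(p.+1, 1 + i))%N.
  by apply: prime_dvd_bin => //; rewrite add1n /= ltnS ltn_ord.
by rewrite mulrnA pV0.
Qed.

Section HomTensor.

Context {p : nat} {p_pr : prime p} {F : fieldExtType (padic_field p_pr)}.
Context {varpi : uniformizer F} {k : fieldType}.

Lemma Bplus_u0 : Bplus_u varpi 0 = 1%g.
Proof. by apply/val_inj/val_inj/mx2P; rewrite /= !mxE. Qed.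

Lemma Bplus_uD (a b : F) :
  Bplus_u varpi (a + b) = (Bplus_u varpi a * Bplus_u varpi b)%g.
Proof.
apply/val_inj/val_inj => /=; rewrite mx2_mul.
by rewrite !(mulr0, mul0r, mul1r, mulr1, addr0, add0r) addrC.
Qed.

Lemma Bplus_diag_u (b : F) : Bplus_diag (Bplus_u varpi b) = 1%g.
Proof. by do 2!apply: val_inj => /=; rewrite mxE /= mx2_1. Qed.

Lemma padic_in1 : padic_in F 1 = 1.
Proof. by rewrite /padic_in rmorph1 scale1r. Qed.

Lemma padic_in0 : padic_in F 0 = 0.
Proof. by rewrite /padic_in rmorph0 scale0r. Qed.

Lemma rep_act_u_nat (V : rep k (Bplus varpi)) (n : nat) (v : V) :
  rep_act (Bplus_u varpi n%:R) v = iter n (Zp_act 1) v.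
Proof.
elim: n => [|n IHn]; first by rewrite Bplus_u0 rep_act1.
by rewrite iterS -IHn /Zp_act padic_in1 -rep_actM -Bplus_uD -natr1 addrC.
Qed.

Lemma DeltaE (V : rep k (Bplus varpi)) (v : V) : Delta v = Zp_act 1 v - v.
Proof. by rewrite /Delta {2}/Zp_act padic_in0 Bplus_u0 rep_act1. Qed.

(** The matrices (1, p^m; 0, 1) converge to 1, so a smooth vector is fixed by
    one of them. *)
Lemma smooth_fixed (V : rep k (Bplus varpi)) (v : V) :
  smooth V -> exists m, rep_act (Bplus_u varpi (p ^ m)%:R) v = v.
Proof.
move=> /(_ v 1%g (rep_act1 v))[m fix_v]; exists m; apply: fix_v => i j.
have int0 : integers (0 : F) by apply: (integral0 (in_alg F \o @tofrac _)).
have int1 : integers (1 : F) by apply: (integral1 (in_alg F \o @tofrac _)).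
case: i => [[|[|//]] lti]; case: j => [[|[|//]] ltj]; rewrite /= !mxE /=.
- by exists 0 => //; rewrite subrr mulr0.
- by exists 1 => //; rewrite subr0 mulr1 natrX.
- by exists 0 => //; rewrite subrr mulr0.
- by exists 0 => //; rewrite subrr mulr0.
Qed.

Section Bilinear.

Variables (pi1 pi2 : rep k (Bplus varpi)).
Variable chi : UMagmaMorphism.type (torus F) (units_of k).
Variable f : tensor_rep pi1 pi2 -> character_rep varpi chi.
Hypothesis f_hom : rep_hom (tensor_rep pi1 pi2) (character_rep varpi chi) f.

Lemma hom_tensDl (x y : pi1) (w : pi2) :
  f (tens (x + y) w) = f (tens x w) + f (tens y w).
Proof.
by rewrite tensDl; have := f_hom.1 1 (tens x w); rewrite !scale1r; apply.
Qed.

Lemma hom_tens_act (g : Bplus varpi) (x : pi1) (w : pi2) :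
  f (tens (rep_act g x) (rep_act g w)) =
    unit_val (chi (Bplus_diag g)) *: f (tens x w).
Proof. by rewrite -tensor_act_tens; apply: (f_hom.2 g (tens x w)). Qed.

Lemma hom_tens_u (b : F) (x : pi1) (w : pi2) :
  f (tens (rep_act (Bplus_u varpi b) x) (rep_act (Bplus_u varpi b) w)) =
    f (tens x w).
Proof. by rewrite hom_tens_act Bplus_diag_u gmulf1 scale1r. Qed.

Hypotheses (p_eq0 : p%:R = 0 :> k) (pi2_smooth : smooth pi2).
Variable W : set pi1.
Hypothesis W_vanishing : vanishing_pair W.

Lemma W_iter_Delta (n : nat) (x : pi1) :
  W x -> exists2 y, W y & x = iter n (@Delta _ _ _ _ _ pi1) y.
Proof.
elim: n x => [|n IHn] x Wx; first by exists x.
move: Wx; rewrite -{1}(vanishing_Delta W_vanishing) => -[z Wz <-].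
by have [y Wy ->] := IHn z Wz; exists y.
Qed.

(** [x] is [u^(p^m) y - y] for some [y], where [u^(p^m)] fixes [w]; as [chi]
    is trivial on unipotent matrices, [f] takes the same value on
    [u^(p^m) y (x) w] and [y (x) w]. *)
Lemma W_tens_eq0 (x : pi1) (w : pi2) : W x -> f (tens x w) = 0.
Proof.
have [m fix_w] := smooth_fixed w pi2_smooth.
move=> /(W_iter_Delta (p ^ m))[y _ ->].
have pV0 (v : pi1) : v *+ p = 0 by rewrite -scaler_nat p_eq0 scale0r.
have ZpE (v : pi1) : Zp_act 1 v = v + Delta v by rewrite DeltaE addrC subrK.
have DeltaD : {morph @Delta _ _ _ _ _ pi1 : v v' / v + v'}.
  by move=> v v'; rewrite !DeltaE /Zp_act linearD opprD addrACA.
have := iter_pow_char m y p_pr pV0 DeltaD ZpE.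
rewrite -rep_act_u_nat => uE.
apply: (addrI (f (tens y w))).
by rewrite -hom_tensDl -uE -{1}fix_w hom_tens_u addr0.
Qed.

(** [f (t^-n x (x) w)] is, up to a scalar, [f (x (x) t^n w)]: the vanishing on
    [W] holds for every [w], so it is insensitive to replacing [w] by
    [t^n w]. *)
Lemma hom_tens_eq0 (v : pi1) (w : pi2) : f (tens v w) = 0.
Proof.
have [m [x [Wx ->]]] := vanishing_sum W_vanishing v.
have tens0 : f (tens 0 w) = 0.
  by apply: (addrI (f (tens 0 w))); rewrite -hom_tensDl !addr0.
rewrite (big_morph (fun y => f (tens y w)) (fun y z => hom_tensDl y z w) tens0).
apply: big1 => n _; set g := (_ ^- n)%g.
have -> : w = rep_act g (rep_act g^-1%g w) by rewrite -rep_actM mulgV rep_act1.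
by rewrite hom_tens_act W_tens_eq0 ?scaler0.
Qed.

End Bilinear.

End HomTensor.

Theorem lemma1p5 (p : nat) (p_pr : prime p)
    (F : fieldExtType (padic_field p_pr)) (varpi : uniformizer F)
    (k : closedFieldType) (iota : {rmorphism 'F_p -> k})
    (k_alg : integralRange iota)
    (pi1 pi2 : rep k (Bplus varpi)) (pi1_vanishing : vanishing pi1)
    (pi2_smooth : smooth pi2)
    (chi : UMagmaMorphism.type (torus F) (units_of k)) :
  rep_hom (tensor_rep pi1 pi2) (character_rep varpi chi) = [set fun=> 0].
Proof.
have [W W_vanishing] := pi1_vanishing.
have p_eq0 : p%:R = 0 :> k.
  by rewrite -(rmorph_nat iota) pchar_Fp_0 // rmorph0.
have lin0 : linear (fun=> 0 : character_rep varpi chi).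
  by move=> c u v; rewrite scaler0 addr0.
apply/seteqP; split=> f /=.
  move=> f_hom; apply/funext; apply: tensor_linear_ext => [||v w].
  - exact: f_hom.1.
  - exact: lin0.
  - exact: (hom_tens_eq0 f_hom p_eq0 pi2_smooth W_vanishing).
by move=> ->; split=> [|g v]; [exact: lin0 | rewrite linear0].
Qed.
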